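(* Let $d$ be a positive integer, let $k$ be a positive integer, and let $H=(V,E)$ be a reduced $d$-flat hypergraph with $V\notin E$. Let $t_0=(\emptyset,\ldots,\emptyset)$ be the $k$-tuple all of whose entries are $\emptyset$. Then the call $\textsc{SolveSetCover}(H,k,t_0)$ runs in $O(k^{dk}\,k\,\|H\|)$ time and correctly solves the instance $(H,k)$ of \textsc{$d$-Flat Set Cover}: if $H$ has a cover of size at most $k$ it returns a set of at most $k$ edges of $E$ forming a cover of $H$, and otherwise it returns $\perp$.
   Context: A hypergraph is a pair $H=(V,E)$ with $V$ a finite set and $E\subseteq 2^V$. Its size is $\|H\|=\sum_{e\in E}|e|$. A cover of $H$ is a set $F\subseteq E$ such that every vertex of $V$ lies in some edge of $F$. For an integer $d\ge 1$, a $d$-semi-ladder in $H$ is a pair $(W,F)$ with $W=\{w_0,\ldots,w_d\}\subseteq V$, $F=\{f_0,\ldots,f_d\}\subseteq E$, such that $w_i\notin f_i$ for all $i\in[0;d]$ and $w_i\in f_j$ whenever $0\le i<j\le d$. $H$ is $d$-semi-ladder-free if it has no $d$-semi-ladder, and $H$ is $d$-flat if it is $(d+1)$-semi-ladder-free. $H$ is reduced if $\bigcap_{e\in E}e=\emptyset$. The problem \textsc{$d$-Flat Set Cover} takes a reduced $d$-flat hypergraph $H$ and an integer $k$ and asks whether $H$ has a cover of size at most $k$. $H$ is intersection-closed if $V\in E$ and $e\cap f\in E$ for all $e,f\in E$; the intersection-closure of $H$ is the smallest intersection-closed hypergraph $H'=(V,E')$ with $E\subseteq E'$. For $S\subseteq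 V$, let $K_H(S)=\{e\in E: S\subseteq e\}$ and let $M_H(S)=V$ if $K_H(S)=\emptyset$, and $M_H(S)=\bigcap_{e\in K_H(S)}e$ otherwise. With $H'=(V,E')$ the intersection-closure of $H$, a $k$-edge-tuple in $H$ is a tuple $t=(e_1,\ldots,e_k)$ with each $e_i\in E'\setminus\{V\}$; for $i\in[k]$ and $e\in E'\setminus\{V\}$, $t[i\to e]$ denotes the tuple obtained from $t$ by replacing its $i$-th entry with $e$. The recursive procedure $\textsc{SolveSetCover}(H,k,t)$, with $t=(e_1,\ldots,e_k)$ a $k$-edge-tuple, is: let $C=e_1\cup\cdots\cup e_k$. If $C=V$, choose for each $i\in[k]$ an edge $f_i\in E$ with $e_i\subseteq f_i$ and return $\{f_1,\ldots,f_k\}$. Otherwise choose some $v\in V\setminus C$; for $i=1,\ldots,k$ in turn: let $f=M_H(e_i\cup\{v\})$; if $f\neq V$, compute $r=\textsc{SolveSetCover}(H,k,t[i\to f])$ and if $r\neq\perp$ return $r$. If the loop ends without returning, return $\perp$.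
   Formalization: In the time bound ‖H‖ is replaced by max(1,‖H‖), since the bound would be 0 for E={∅}; the O-constant is absolute for k≥2 but may depend on d for k=1, where a run can make d+1 nested calls, each scanning H; time is counted in unit-cost elementary steps. *)

(* Defs.v *)
From mathcomp Require Import all_boot.
Set Implicit Arguments.
Unset Strict Implicit.
Unset Printing Implicit Defensive.

Section Hypergraphs.
(* The hypergraph (V, E) has vertex set V = [set: T] and edge set E. *)
Variables (T : finType) (E : {set {set T}}).

Definition hsize : nat := \sum_(e in E) #|e|.

Definition is_cover (F : {set {set T}}) : bool :=
  (F \subset E) && (cover F == [set: T]).

Definition has_cover (k : nat) : bool :=
  [exists F : {set {set T}}, is_cover F && (#|F| <= k)].

Definition semi_ladder (d : nat) (w : 'I_d.+1 -> T) (f : 'I_d.+1 -> {set T})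
    : Prop :=
  [/\ forall i, f i \in E,
      forall i, w i \notin f i &
      forall i j : 'I_d.+1, i < j -> w i \in f j].

Definition semi_ladder_free (d : nat) : Prop :=
  forall w f, ~ @semi_ladder d w f.

Definition flat (d : nat) : Prop := semi_ladder_free d.+1.

(* The empty intersection is V, the convention also used in [MH]. *)
Definition reduced : bool := \bigcap_(e in E) e == set0.

Definition KH (S : {set T}) : {set {set T}} := [set e in E | S \subset e].

(* Equal to V when KH S is empty. *)
Definition MH (S : {set T}) : {set T} := \bigcap_(e in KH S) e.

Definition inter_closed (E' : {set {set T}}) : bool :=
  ([set: T] \in E') && [forall e in E', forall f in E', e :&: f \in E'].

Definition inter_closure : {set {set T}} :=
  \bigcap_(E' : {set {set T}} | inter_closed E' && (E \subset E')) E'.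

Definition edge_tuple (k : nat) (t : {ffun 'I_k -> {set T}}) : bool :=
  [forall i, t i \in inter_closure :\ [set: T]].

End Hypergraphs.

Definition upd (T : finType) (k : nat) (t : {ffun 'I_k -> {set T}})
    (i : 'I_k) (e : {set T}) : {ffun 'I_k -> {set T}} :=
  [ffun j => if j == i then e else t j].

(******************************************************************************)
(* Cost model.  Running time is measured on a unit-cost random access machine *)
(* with zero-initialised memory.  A value of type [timed A] is a result       *)
(* together with the number of elementary operations spent on it.  The only   *)
(* elementary operations are those built with [op], at cost 1 each: access to *)
(* one cell of a boolean array indexed by V, increment or comparison of       *)
(* counters, consing on a list, and advancing in a list or testing its end.   *)
(* [ret] and [bind] only pass references around and are free.                 *)
(* A boolean array indexed by V is represented by the set of its true cells.  *)
(* Scratch arrays are all false initially, and are reset after use.           *)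
(******************************************************************************)
Definition timed (A : Type) : Type := (A * nat)%type.
Definition ret (A : Type) (a : A) : timed A := (a, 0).
Definition op (A : Type) (a : A) : timed A := (a, 1).
Definition bind (A B : Type) (m : timed A) (g : A -> timed B) : timed B :=
  ((g m.1).1, m.2 + (g m.1).2).

Notation "'let*' x := m 'in' g" := (bind m (fun x => g))
  (at level 200, x name, g at level 200, right associativity).

Fixpoint foldT (A B : Type) (f : B -> A -> timed B) (b : B) (s : seq A)
    : timed B :=
  if s is x :: s' then
    let* x := op x in
    let* b' := f b x in
    foldT f b' s'
  else op b.

Fixpoint filterT (A : Type) (a : A -> timed bool) (s : seq A) : timed (seq A) :=
  if s is x :: s' then
    let* x := op x in
    let* b := a x in
    let* r := filterT a s' in
    if b then op (x :: r) else ret r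
  else op [::].

Fixpoint findT (A : Type) (a : A -> timed bool) (s : seq A) : timed (option A) :=
  if s is x :: s' then
    let* x := op x in
    let* b := a x in
    if b then ret (Some x) else findT a s'
  else op None.

Definition incr (n : nat) : timed nat := op n.+1.
Definition eqT (m n : nat) : timed bool := op (m == n).
Definition lengthT (A : Type) (s : seq A) : timed nat :=
  foldT (fun n _ => incr n) 0 s.

Section Routines.
Variable T : finType.

Definition read (x : T) (A : {set T}) : timed bool := op (x \in A).
Definition write1 (x : T) (A : {set T}) : timed {set T} := op (x |: A).
Definition write0 (x : T) (A : {set T}) : timed {set T} := op (A :\ x).

Definition mark (s : seq T) (A : {set T}) : timed {set T} :=
  foldT (fun A x => write1 x A) A s.
Definition unmark (s : seq T) (A : {set T}) : timed {set T} :=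
  foldT (fun A x => write0 x A) A s.

(* [A] is the array marking a set of size [m]. *)
Definition contains (A : {set T}) (m : nat) (e : seq T) : timed bool :=
  let* n := foldT (fun n x =>
              let* b := read x A in if b then incr n else ret n) 0 e in
  eqT n m.

Definition interT (s e : seq T) : timed (seq T) :=
  let* A := mark e set0 in
  let* r := filterT (fun x => read x A) s in
  let* A := unmark e A in
  ret r.

(* The intersection of the lists in [es] that contain [S], or [None] if there *)
(* are none.                                                                  *)
Definition closureT (es : seq (seq T)) (S : seq T) : timed (option (seq T)) :=
  let* A := mark S set0 in
  let* m := lengthT S in
  let* r := foldT (fun r e =>
              let* b := contains A m e in
              if b then
                if r is Some g then let* g' := interT g e in ret (Some g')
                else ret (Some e)
              else ret r) None es in
  let* A := unmark S A in
  ret r.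

Section Steps.
Variables (k : nat) (E : {set {set T}}) (t : {ffun 'I_k -> {set T}}).

(* A set S is stored as the duplicate-free list [enum S], E as the list of    *)
(* its edges, and |V| is known.                                               *)

(* The test C = V for C = \bigcup_i t i; if it fails, the first vertex        *)
(* outside C in the list [vs] of all vertices.                                *)
Definition uncoveredT (vs : seq T) : timed (option T) :=
  let* An := foldT (fun An i =>
               foldT (fun An x =>
                 let* b := read x An.1 in
                 if b then ret An else
                 let* A := write1 x An.1 in
                 let* n := incr An.2 in
                 ret (A, n)) An (enum (t i))) (set0, 0) (enum 'I_k) in
  let* full := eqT An.2 #|T| in
  let* v := (if full then ret None
             else findT (fun x => let* b := read x An.1 in ret (~~ b)) vs) in
  let* A := foldT (fun A i => unmark (enum (t i)) A) An.1 (enum 'I_k) in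
  ret v.

(* M_H(t i :|: [set v]), or [None] if it is V, for v outside t i. *)
Definition extendT (i : 'I_k) (v : T) : timed (option (seq T)) :=
  let* r := closureT [seq enum (e : {set T}) | e <- enum E] (v :: enum (t i)) in
  if r is Some f then
    let* n := lengthT f in
    let* full := eqT n #|T| in
    ret (if full then None else Some f)
  else ret None.

(* For each i, the first edge of the list [es i] of all edges that contains   *)
(* t i, if any.                                                               *)
Definition chooseT (es : 'I_k -> seq {set T}) : timed (seq {set T}) :=
  foldT (fun r i =>
    let* A := mark (enum (t i)) set0 in
    let* m := lengthT (enum (t i)) in
    let* f := findT (fun e : {set T} => contains A m (enum e)) (es i) in
    let* A := unmark (enum (t i)) A in
    if f is Some e then op (e :: r) else ret r) [::] (enum 'I_k).

End Steps.
End Routines.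

(******************************************************************************)
(* SolveSetCover.  The calls made during one run are identified by the path   *)
(* p : seq 'I_k of loop indices leading from the initial call to them.  The   *)
(* free choices are made by scanning the vertices (edges) in the order        *)
(* [vo p] (resp. [eo p i]) and taking the first admissible one; letting these *)
(* orders range over all enumerations of V (resp. E) yields all possible runs *)
(* of the procedure.                                                          *)
(*   solve_call p t r c: the call at p with argument t returns r ([None] is   *)
(*     the answer bottom) after c elementary operations;                      *)
(*   solve_loop p t v s r c: likewise for its loop, with chosen vertex v, when*)
(*     the indices in s remain to be treated.                                 *)
(* The relation is inductive, so it only relates terminating computations.    *)
(* The tuple is updated in place: its i-th entry is overwritten before a      *)
(* recursive call and restored after an unsuccessful one.                     *)
(******************************************************************************)
Section Solve.
Variables (T : finType) (E : {set {set T}}) (k : nat).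
Variables (vo : seq 'I_k -> seq T) (eo : seq 'I_k -> 'I_k -> seq {set T}).

Definition first (A : Type) (a : pred A) (s : seq A) : option A :=
  ohead (filter a s).

Definition union_of (t : {ffun 'I_k -> {set T}}) : {set T} := \bigcup_i t i.

(* Every t i lies in an edge when called from the initial tuple, except in    *)
(* the degenerate case that V is empty, where no edge is selected.            *)
Definition chosen_edges (p : seq 'I_k) (t : {ffun 'I_k -> {set T}})
    : {set {set T}} :=
  [set f | [exists i, first (fun e : {set T} => t i \subset e) (eo p i) == Some f]].

Inductive solve_call : seq 'I_k -> {ffun 'I_k -> {set T}} ->
    option {set {set T}} -> nat -> Prop :=
| solve_covered p t :
    union_of t = [set: T] ->
    solve_call p t (Some (chosen_edges p t))
      (1 (* call *) + (uncoveredT t (vo p)).2 + (chooseT t (eo p)).2)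
| solve_branch p t v r c :
    union_of t != [set: T] ->
    first (fun x => x \notin union_of t) (vo p) = Some v ->
    solve_loop p t v (enum 'I_k) r c ->
    solve_call p t r (1 (* call *) + (uncoveredT t (vo p)).2 + c)
with solve_loop : seq 'I_k -> {ffun 'I_k -> {set T}} -> T -> seq 'I_k ->
    option {set {set T}} -> nat -> Prop :=
| loop_end p t v :
    solve_loop p t v [::] None 1 (* end of loop *)
| loop_skip p (t : {ffun 'I_k -> {set T}}) v i s r c :
    MH E (v |: t i) = [set: T] ->
    solve_loop p t v s r c ->
    solve_loop p t v (i :: s) r
      (1 (* advance *) + (extendT E t i v).2 + c)
| loop_success p (t : {ffun 'I_k -> {set T}}) v i s F c :
    MH E (v |: t i) != [set: T] ->
    solve_call (rcons p i) (upd t i (MH E (v |: t i))) (Some F) c ->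
    solve_loop p t v (i :: s) (Some F)
      (1 (* advance *) + (extendT E t i v).2
       + 1 (* overwrite *) + c + 1 (* test result *))
| loop_next p (t : {ffun 'I_k -> {set T}}) v i s r c c' :
    MH E (v |: t i) != [set: T] ->
    solve_call (rcons p i) (upd t i (MH E (v |: t i))) None c ->
    solve_loop p t v s r c' ->
    solve_loop p t v (i :: s) r
      (1 (* advance *) + (extendT E t i v).2
       + 1 (* overwrite *) + c + 1 (* test result *) + 1 (* restore *) + c').

End Solve.

(******************************************************************************)
(* The routines compute what the steps of the procedure require, the run for  *)
(* given orders is unique, and all recursive calls are on k-edge-tuples.      *)
(******************************************************************************)
Scheme solve_call_mind := Minimality for solve_call Sort Prop
with solve_loop_mind := Minimality for solve_loop Sort Prop.

Section Validation.
Variable T : finType.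
Implicit Types A S : {set T}.

Lemma bindE (A B : Type) (m : timed A) (g : A -> timed B) :
  (bind m g).1 = (g m.1).1.
Proof. by []. Qed.

Lemma foldTE (A B : Type) (f : B -> A -> timed B) b s :
  (foldT f b s).1 = foldl (fun b x => (f b x).1) b s.
Proof. by elim: s b => //= x s IH b; rewrite IH. Qed.

Lemma filterTE (A : Type) (a : A -> timed bool) s :
  (filterT a s).1 = filter (fun x => (a x).1) s.
Proof. by elim: s => //= x s <-; case: ifP. Qed.

Lemma findTE (A : Type) (a : A -> timed bool) s :
  (findT a s).1 = first (fun x => (a x).1) s.
Proof.
by rewrite /first; elim: s => //= x s IH; case: (a x).1.
Qed.

Lemma first_ext (A : Type) (a b : pred A) (s : seq A) :
  a =1 b -> first a s = first b s.
Proof. by move=> ab; rewrite /first (eq_filter ab). Qed.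

Lemma lengthTE (A : Type) (s : seq A) : (lengthT s).1 = size s.
Proof.
rewrite /lengthT foldTE /= -[size s]addn0.
by elim: s 0 => //= x s IH n; rewrite IH addnS.
Qed.

Lemma markE (s : seq T) A : (mark s A).1 = A :|: [set x in s].
Proof.
rewrite /mark foldTE; elim: s A => [|x s IH] A /=.
  by apply/setP=> y; rewrite !inE orbF.
by rewrite IH; apply/setP=> y; rewrite !inE; case: (y == x); rewrite ?orbT.
Qed.

Lemma mark0E (s : seq T) : (mark s set0).1 = [set x in s].
Proof. by rewrite markE set0U. Qed.

Lemma unmarkE (s : seq T) A : (unmark s A).1 = A :\: [set x in s].
Proof.
rewrite /unmark foldTE; elim: s A => [|x s IH] A /=.
  by apply/setP=> y; rewrite !inE.
by rewrite IH; apply/setP=> y; rewrite !inE; case: (y == x); rewrite ?andbF.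
Qed.

Lemma containsE S (f : {set T}) : (contains S #|S| (enum f)).1 = (S \subset f).
Proof.
rewrite /contains /= foldTE.
have -> n s : foldl (fun n x => (let* b := read x S in
            if b then incr n else ret n).1) n s = n + count (mem S) s.
  elim: s n => [|x s IH] n //=; first by rewrite addn0.
  by rewrite IH; case: (x \in S); rewrite ?addSn ?addnS.
rewrite add0n -size_filter.
have -> : size [seq x <- enum f | x \in S] = #|S :&: f|.
  rewrite cardE; apply: perm_size; apply: uniq_perm.
  - by rewrite filter_uniq ?enum_uniq.
  - exact: enum_uniq.
  by move=> x; rewrite mem_filter !mem_enum inE.
by rewrite (sameP setIidPl eqP) eqEcard subsetIl eqn_leq subset_leq_card ?subsetIl.
Qed.

Lemma interTE (s e : seq T) : (interT s e).1 = [seq x <- s | x \in e].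
Proof.
rewrite /interT /= filterTE mark0E; apply: eq_filter => x.
by rewrite /= inE.
Qed.

Lemma enum_setI S (f : {set T}) : [seq x <- enum S | x \in f] = enum (S :&: f).
Proof.
rewrite /enum_mem -filter_predI; apply: eq_filter => x /=.
by rewrite !inE andbC.
Qed.

Lemma closureTE (E : {set {set T}}) S (s : seq T) : uniq s -> s =i S ->
  (closureT [seq enum (e : {set T}) | e <- enum E] s).1 =
  if KH E S == set0 then None else Some (enum (MH E S)).
Proof.
move=> us sS; rewrite /closureT !bindE foldTE mark0E lengthTE.
have -> : [set x in s] = S by apply/setP=> x; rewrite inE sS.
have -> : size s = #|S| by rewrite -(eq_card sS); exact/esym/card_uniqP.
set g := fun r e => _.
have gE r (f : {set T}) : g r (enum f) =
    if S \subset f then Some (if r is Some h then [seq x <- h | x \in enum f]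
                              else enum f) else r.
  rewrite /g bindE containsE; case: ifP => // _; case: r => [h|] //.
  by rewrite bindE interTE.
move: (g) gE => {}g gE.
have gS (h : {set T}) (es : seq {set T}) :
    foldl g (Some (enum h)) [seq enum f | f : {set T} <- es] =
    Some (enum (h :&: \bigcap_(f <- es | S \subset f) f)).
  elim: es h => [|f es IH] h /=; first by rewrite big_nil setIT.
  rewrite gE big_cons; case: ifP => _ //.
  rewrite (eq_filter (a2 := mem f)) => [|x]; last by rewrite /= mem_enum.
  by rewrite enum_setI IH setIA.
have gN (es : seq {set T}) : foldl g None [seq enum f | f : {set T} <- es] =
    if has (fun f : {set T} => S \subset f) es
    then Some (enum (\bigcap_(f <- es | S \subset f) f)) else None.
  by elim: es => [|f es IH] //=; rewrite gE big_cons; case: ifP.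
rewrite gN; have -> : \bigcap_(f <- enum E | S \subset f) f = MH E S.
  by rewrite big_enum_cond; apply: eq_bigl => f; rewrite inE.
rewrite -if_neg; congr (if _ then _ else _).
apply/hasP/set0Pn => [[f]|[f]].
  by rewrite mem_enum => fE Sf; exists f; rewrite inE fE.
by rewrite inE => /andP[fE Sf]; exists f; rewrite ?mem_enum.
Qed.

Lemma extendTE (E : {set {set T}}) k (t : {ffun 'I_k -> {set T}}) i v :
  v \notin t i ->
  (extendT E t i v).1 =
  if MH E (v |: t i) == [set: T] then None else Some (enum (MH E (v |: t i))).
Proof.
move=> vt; rewrite /extendT bindE.
rewrite (@closureTE E (v |: t i)).
- case: ifP => [/eqP K0|_].
    by rewrite /MH K0 big_set0 eqxx.
  rewrite !bindE lengthTE -cardE /=; set M := MH _ _.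
  by rewrite eqEcard subsetT cardsT eqn_leq max_card.
- by rewrite /= mem_enum vt enum_uniq.
by move=> x; rewrite !inE mem_enum.
Qed.

Lemma uncoveredTE k (t : {ffun 'I_k -> {set T}}) vs :
  (uncoveredT t vs).1 =
  if union_of t == [set: T] then None
  else first (fun x => x \notin union_of t) vs.
Proof.
rewrite /uncoveredT /= !foldTE; set G := fun An i => _.
have GE (A : {set T}) i : G (A, #|A|) i = (A :|: t i, #|A :|: t i|).
  rewrite /G foldTE; set g := fun An x => _.
  have -> s : foldl g (A, #|A|) s = (A :|: [set x in s], #|A :|: [set x in s]|).
    elim: s A => [|x s IH] A /=.
      by congr pair; [|congr #|pred_of_set _|];
         apply/setP=> y; rewrite !inE orbF.
    have -> : g (A, #|A|) x = (x |: A, #|x |: A|).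
      rewrite /g /=; case: ifP => /= xA; last by rewrite cardsU1 xA.
      by rewrite (setUidPr _) // sub1set.
    rewrite IH; have -> // : x |: A :|: [set x in s] = A :|: [set y in x :: s].
    by apply/setP=> y; rewrite !inE; case: (y == x); rewrite ?orbT.
  have -> // : [set x in enum (t i)] = t i.
  by apply/setP=> x; rewrite inE mem_enum.
have -> : foldl G (set0, 0) (enum 'I_k) = (union_of t, #|union_of t|).
  have Gs s (A : {set T}) : foldl G (A, #|A|) s =
      (A :|: \bigcup_(i <- s) t i, #|A :|: \bigcup_(i <- s) t i|).
    elim: s A => [|i s IH] A; first by rewrite big_nil setU0.
    by rewrite /= GE IH big_cons setUA.
  have /= := Gs (enum 'I_k) set0; rewrite cards0 set0U => ->.
  by rewrite big_enum.
rewrite /= [in RHS]eqEcard subsetT cardsT eqn_leq max_card.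
by case: ifP => //= _; rewrite findTE.
Qed.

Lemma chooseTE k (t : {ffun 'I_k -> {set T}})
    (eo : seq 'I_k -> 'I_k -> seq {set T}) (p : seq 'I_k) :
  [set f in (chooseT t (eo p)).1] = chosen_edges eo p t.
Proof.
rewrite /chooseT foldTE; set g := (X in foldl X).
have gE r i : g r i = if first (fun e : {set T} => t i \subset e) (eo p i)
                         is Some f then f :: r else r.
  rewrite /g !bindE mark0E lengthTE -cardE findTE.
  have -> : [set x in enum (t i)] = t i.
    by apply/setP=> x; rewrite inE mem_enum.
  rewrite (first_ext (b := fun e : {set T} => t i \subset e)).
    by case: first.
  by move=> e; rewrite containsE.
have H s r f : (f \in foldl g r s) = (f \in r) ||
    has (fun i => first (fun e : {set T} => t i \subset e) (eo p i) == Some f) s.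
  elim: s r => [|i s IH] r /=; first by rewrite orbF.
  rewrite IH gE; case: first => [h|] //=.
  by rewrite inE -orbA orbCA [Some _ == _]eq_sym [Some f == _]/eq_op /= orbA.
apply/setP=> f; rewrite !inE H in_nil /=.
apply/hasP/existsP => [[i _ fi]|[i fi]]; exists i => //.
by rewrite mem_enum.
Qed.

Lemma solve_call_unique (E : {set {set T}}) k vo eo (p : seq 'I_k) t r c r' c' :
  solve_call E vo eo p t r c -> solve_call E vo eo p t r' c' ->
  r = r' /\ c = c'.
Proof.
move=> H; move: r' c'.
pose P p t r c := forall r' c', solve_call E vo eo p t r' c' ->
  r = r' /\ c = c'.
pose Q p t v s r c := forall r' c', solve_loop E vo eo p t v s r' c' ->
  r = r' /\ c = c'.
apply: (@solve_call_mind T E k vo eo P Q) H; rewrite /P /Q.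
- move=> {}p {}t tT r' c' H; inversion H; subst => //.
  by move: H0; rewrite tT eqxx.
- move=> {}p {}t v {}r {}c tT fv _ IH r' c' H; inversion H; subst.
    by move: tT; rewrite H0 eqxx.
  by move: H1; rewrite fv => -[vv]; subst; case: (IH _ _ H2) => -> ->.
- by move=> {}p {}t v r' c' H; inversion H.
- move=> {}p {}t v i s {}r {}c M _ IH r' c' H; inversion H; subst;
    match goal with
    | N : is_true (MH _ _ != _) |- _ => by rewrite M eqxx in N
    | L : solve_loop _ _ _ _ _ _ _ _ _ |- _ =>
        solve [by case: (IH _ _ L) => -> ->]
    end.
- move=> {}p {}t v i s F {}c M _ IH r' c' H; inversion H; subst;
    match goal with
    | N : MH _ _ = _ |- _ => by rewrite N eqxx in M
    | L : solve_call _ _ _ _ _ _ _ |- _ => by case: (IH _ _ L) => // -[->] ->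
    end.
move=> {}p {}t v i s {}r c1 c2 M _ IH1 _ IH2 r' c' H; inversion H; subst;
  match goal with
  | N : MH _ _ = _ |- _ => by rewrite N eqxx in M
  | L : solve_call _ _ _ _ _ _ _ |- _ => case: (IH1 _ _ L) => // _ ->
  end.
match goal with L : solve_loop _ _ _ _ _ _ _ _ _ |- _ =>
  solve [by case: (IH2 _ _ L) => -> ->] end.
Qed.

Lemma inter_closure_bigcap (E F : {set {set T}}) : F \subset E ->
  \bigcap_(e in F) e \in inter_closure E.
Proof.
move=> FE; apply/bigcapP => E' /andP[/andP[ET /forall_inP EI] EE].
elim/big_ind: _ => // [e f eE fE|e eF].
  by move/forall_inP: (EI _ eE); apply.
by apply: (subsetP EE); apply: (subsetP FE).
Qed.

Lemma edge_tuple_init (E : {set {set T}}) k : reduced E -> 0 < #|T| ->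
  edge_tuple E [ffun _ : 'I_k => set0].
Proof.
move=> /eqP rE T0; apply/forallP => i; rewrite ffunE !inE -{2}rE.
rewrite inter_closure_bigcap // andbT.
by apply: contraTneq T0 => T0; rewrite -cardsT -T0 cards0.
Qed.

Lemma edge_tuple_upd (E : {set {set T}}) k (t : {ffun 'I_k -> {set T}}) i v :
  edge_tuple E t -> MH E (v |: t i) != [set: T] ->
  edge_tuple E (upd t i (MH E (v |: t i))).
Proof.
move=> /forallP tE M; apply/forallP => j; rewrite ffunE.
case: (j == i) => //; rewrite in_setD1 M inter_closure_bigcap //.
by apply/subsetP => e; rewrite inE => /andP[].
Qed.

End Validation.

(* Main.v *)
(******************************************************************************)
(* Each entry of the tuple is a closed set M_H(S).  Enlarging it by a vertex  *)
(* v outside adds a pair (v, f) to a semi-ladder, where f is an edge          *)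
(* containing the old entry but not v; and one further pair can be added as   *)
(* long as the new entry is not V.  In a d-flat hypergraph an entry therefore *)
(* changes at most d times, and the search tree has depth at most dk and      *)
(* branching k.  One call costs O(k N) with N = max(1, ||H||), because        *)
(* |E| <= ||H|| + 1 and every entry lies in an edge.  The tree has            *)
(* \sum_(j <= dk) k^j nodes, which is at most 2 k^(dk) if k > 1 but d + 1 if  *)
(* k = 1.  If edges g_1, ..., g_k cover V and contain the respective entries, *)
(* then the chosen vertex v lies in some g_i, so the i-th branch keeps all    *)
(* entries inside the g_j; hence a cover is not missed.                       *)
(******************************************************************************)
Require Import Defs.
From mathcomp Require Import all_boot.
From mathcomp Require Import zify.

Set Implicit Arguments.
Unset Strict Implicit.
Unset Printing Implicit Defensive.

(** Correctness and running time come out of one induction, [solve_call_spec], on a budget [m] of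
    remaining updates. Each entry of the tuple carries a semi-ladder recording its updates; flatness
    caps the length at [d] ([ladder_extend_size]), so [search_inv] is contradictory at budget 0 and
    the search terminates. Along the way, any returned set is a small cover ([chosen_edges_sound]),
    and some branch preserves a cover lying above the tuple ([coverable_upd]), so bottom is returned
    only if there is none. The cost of one call must be charged to ||H||, yet isolated vertices can
    make |V| arbitrarily larger. Hence [uncoveredT_cost] charges the search for a vertex to the
    entries, and [closureT_cost] charges the repeated intersections to the edges. *)

Lemma bind_cost (A B : Type) (m : timed A) (g : A -> timed B) :
  (bind m g).2 = m.2 + (g m.1).2.
Proof. by []. Qed.

(** * Cost of the list combinators *)

Section FoldCost.
Variables A B : Type.
Implicit Types (f : B -> A -> timed B) (b : B) (s : seq A) (w : A -> nat).

(** The potential method: [pot] is credit stored in the accumulator, and [P] and [Q] are invariants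
    of the accumulator and the items. The successors count the advances and the final end test. *)
Lemma foldT_amortized_cost f (Q : pred A) (P : pred B) (pot : B -> nat) w s b :
  all Q s -> P b ->
  (forall b x, Q x -> P b ->
     P (f b x).1 /\ (f b x).2 + pot (f b x).1 <= w x + pot b) ->
  (foldT f b s).2 <= (pot b + \sum_(x <- s) (w x).+1).+1.
Proof.
move=> + + Pf; elim: s b => [|x s IH] b //= /andP[Qx Qs] Pb; rewrite big_cons.
by have [/(IH _ Qs)] := Pf b x Qx Pb; lia.
Qed.

Lemma foldT_cost f w s b : (forall b x, (f b x).2 <= w x) ->
  (foldT f b s).2 <= (\sum_(x <- s) (w x).+1).+1.
Proof.
move=> fw.
apply: (@foldT_amortized_cost f predT predT (fun=> 0)) => [||{}b x _ _] //=.
  exact: all_predT.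
by rewrite !addn0.
Qed.

Lemma foldT_cost_const f n s b : (forall b x, (f b x).2 <= n) ->
  (foldT f b s).2 <= (n.+1 * size s).+1.
Proof.
move/(foldT_cost (w := fun=> n) s b).
by rewrite big_const_seq count_predT iter_addn_0.
Qed.

Lemma foldT_measure f (mu : B -> nat) w s b :
  (forall b x, mu (f b x).1 <= mu b + w x) ->
  mu (foldT f b s).1 <= mu b + \sum_(x <- s) w x.
Proof.
move=> fw; elim: s b => [|x s IH] b /=; first by rewrite big_nil addn0.
by rewrite big_cons addnA (leq_trans (IH _)) // leq_add2r.
Qed.

End FoldCost.

Lemma filterT_cost (A : Type) (a : A -> timed bool) n s :
  (forall x, (a x).2 <= n) -> (filterT a s).2 <= (n.+2 * size s).+1.
Proof.
move=> an; elim: s => //= x s IH; have := an x.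
by case: (a x).1 => /=; nia.
Qed.

Lemma findT_cost (A : Type) (a : A -> timed bool) w s :
  (forall x, (a x).2 <= w x) -> (findT a s).2 <= (\sum_(x <- s) (w x).+1).+1.
Proof.
move=> aw; elim: s => //= x s IH; have := aw x; rewrite big_cons.
by case: (a x).1 => /=; lia.
Qed.

(** Only rejected elements and at most one accepted one are inspected, so the length of the list
    does not enter the bound. *)
Lemma findT_cost_count (A : Type) (a : A -> timed bool) n s :
  (forall x, (a x).2 <= n) ->
  (findT a s).2 <= (count (fun x => ~~ (a x).1) s).+1 * n.+1.
Proof.
move=> an; elim: s => [|x s IH] /=; first by lia.
by have := an x; case: (a x).1 => /=; nia.
Qed.

(** * Cost of the steps of one call in terms of ||H|| *)

Section RoutineCosts.
Variable T : finType.
Implicit Types (A S : {set T}) (E : {set {set T}}) (s e : seq T).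

Lemma mark_cost s A : (mark s A).2 <= (2 * size s).+1.
Proof. exact: foldT_cost_const. Qed.

Lemma unmark_cost s A : (unmark s A).2 <= (2 * size s).+1.
Proof. exact: foldT_cost_const. Qed.

Lemma lengthT_cost (X : Type) (s : seq X) : (lengthT s).2 <= (2 * size s).+1.
Proof. exact: foldT_cost_const. Qed.

Lemma contains_cost A m e : (contains A m e).2 <= (3 * size e).+2.
Proof.
rewrite /contains /= addn1 ltnS; apply: foldT_cost_const => n x /=.
by case: ifP.
Qed.

Lemma interT_cost s e : (interT s e).2 <= 4 * size e + 3 * size s + 3.
Proof.
rewrite /interT /= addn0.
have := mark_cost e set0; set A := (mark e set0).1.
have := unmark_cost e A.
have := @filterT_cost T (fun x => read x A) 1 s (fun=> leqnn _).
by lia.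
Qed.

(* The running intersection is contained in the last edge added to it, so the *)
(* cost of intersecting it with the next one can be charged to that edge.     *)
Lemma closureT_cost (es : seq (seq T)) s : all uniq es ->
  (closureT es s).2 <= 6 * size s + 4 + \sum_(e <- es) (10 * size e + 6).
Proof.
move=> ues; rewrite /closureT /= addn0.
set A := (mark s set0).1; set m := (lengthT s).1; set f := fun r e => bind _ _.
have fold_cost : (foldT f None es).2 <= (\sum_(e <- es) (10 * size e + 6)).+1.
  rewrite (eq_bigr (fun e => (10 * size e + 5).+1)); last by move=> *; lia.
  (* The credit pays for the next scan of [g] in [interT], at 3 per element. Duplicate-freeness is
     what makes the new intersection no longer than [e]. *)
  pose P r := if r is Some g then @uniq T g else true.
  pose pot r := if r is Some g then 3 * @size T g else 0.
  apply: (@foldT_amortized_cost _ _ f uniq P pot) => // r e ue Pr.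
  rewrite /f bindE bind_cost; have := contains_cost A m e.
  case: (contains A m e) => -[] c /= le_c; last by split=> //; lia.
  case: r Pr => [g|] ug; last by split; [exact: ue | move=> /=; lia].
  rewrite bindE bind_cost; move: (interT_cost g e) (interTE g e).
  case: (interT g e) => g' c' /= le_c' g'E.
  have ug' : uniq g' by rewrite g'E; apply: filter_uniq.
  have : size g' <= size e.
    by apply: uniq_leq_size => // x; rewrite g'E mem_filter => /andP[].
  by split=> //; lia.
have := mark_cost s set0; have := lengthT_cost s; have := unmark_cost s A.
by lia.
Qed.

Lemma edge_leq_hsize E S : S \in E -> #|S| <= hsize E.
Proof. by move=> SE; rewrite /hsize (bigD1 S) //= leq_addr. Qed.

(** Every edge adds at least 1 to the size, except possibly the empty one. *)
Lemma card_edges_leq E : #|E| <= (hsize E).+1.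
Proof.
rewrite (cardsD1 set0) -add1n leq_add ?leq_b1 // -sum1_card /hsize.
rewrite [leqRHS](big_setID [set set0]) /= (leq_trans _ (leq_addl _ _)) //.
by apply: leq_sum => e; rewrite !inE card_gt0 => /andP[].
Qed.

Lemma sum_edges_leq E (es : seq {set T}) a b : perm_eq es (enum E) ->
  \sum_(e <- es) (a * size (enum e) + b) <= (a + b) * hsize E + b.
Proof.
move=> esE; rewrite (perm_big (enum E) esE) big_enum big_split.
rewrite -big_distrr /= sum_nat_const.
have -> : \sum_(e in E) size (enum e) = hsize E.
  by apply: eq_bigr => e _; rewrite -cardE.
by rewrite mulnDl -addnA leq_add2l -mulnSr mulnC leq_mul2l card_edges_leq orbT.
Qed.

Lemma MH_leq_hsize E S : KH E S != set0 -> #|MH E S| <= hsize E.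
Proof.
move=> /set0Pn[e eK].
rewrite (leq_trans (subset_leq_card (bigcap_inf e eK))) //.
by apply: edge_leq_hsize; move: eK; rewrite inE => /andP[].
Qed.

Section StepCosts.
Variables (E : {set {set T}}) (k : nat) (t : {ffun 'I_k -> {set T}}) (h : nat).
Hypothesis t_small : forall i, #|t i| <= h.

Lemma uncoveredT_cost vs : perm_eq vs (enum T) ->
  (uncoveredT t vs).2 <= 8 * (k * h) + 4 * k + 5.
Proof.
move=> vsT; rewrite /uncoveredT /= addn0.
set G := fun (An : {set T} * nat) (i : 'I_k) => foldT _ An _.
set U := fun (A : {set T}) (i : 'I_k) => unmark _ A.
have sum_t a b : \sum_(i <- enum 'I_k) (a * size (enum (t i)) + b) <=
    a * (k * h) + b * k.
  rewrite big_enum big_split -big_distrr /= !sum_nat_const card_ord mulnC.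
  rewrite (mulnC b) leq_add2r mulnC leq_mul2l.
  have -> : k * h = \sum_(i < k) h by rewrite sum_nat_const card_ord.
  by rewrite leq_sum ?orbT // => i _; rewrite -cardE.
have sum_t1 a b : (\sum_(i <- enum 'I_k) (a * size (enum (t i)) + b)).+1 <=
    a * (k * h) + b * k + 1 by rewrite addn1 ltnS.
have fill_cost : (foldT G (set0, 0) (enum 'I_k)).2 <= 4 * (k * h) + 2 * k + 1.
  apply: leq_trans (sum_t1 4 2).
  under eq_bigr do rewrite addn2.
  apply: (@foldT_cost _ _ _ (fun i => (4 * size (enum (t i))).+1)) => An i.
  by apply: foldT_cost_const => {}An x /=; case: ifP.
set An := (foldT G _ _).1.
have An_small : #|An.1| <= k * h.
  have := sum_t 1 0; rewrite mul1n addn0; apply: leq_trans.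
  have := @foldT_measure _ _ G (fun An => #|An.1|)
    (fun i => 1 * size (enum (t i)) + 0) (enum 'I_k) (set0, 0).
  rewrite cards0 add0n; apply => {}An i; rewrite addn0 mul1n -sum1_size.
  apply: (@foldT_measure _ _ _ (fun An : {set T} * nat => #|An.1|)).
  move=> {}An x /=.
  by case: ifP => [_|xAn] /=; rewrite ?leq_addr // cardsU1 xAn addnC.
have unmark_costs A : (foldT U A (enum 'I_k)).2 <= 2 * (k * h) + 2 * k + 1.
  apply: leq_trans (sum_t1 2 2).
  under eq_bigr do rewrite addn2.
  apply: (@foldT_cost _ _ _ (fun i => (2 * size (enum (t i))).+1)) => {}A i.
  exact: unmark_cost.
have := unmark_costs An.1.
set c := (X in 1 + (X + _)); have : c <= 2 * (k * h) + 2; last by lia.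
rewrite /c; case: ifP => //= _.
set a := fun x => _.
have := @findT_cost_count _ a 1 vs (fun=> leqnn _).
(* The vertices rejected by the search are exactly the marked ones, so the scan is paid for by the
   entries. *)
have -> : count (fun x => ~~ (a x).1) vs = #|An.1|.
  rewrite (permP vsT) -size_filter cardE; apply: perm_size; apply: uniq_perm.
  - by rewrite filter_uniq ?enum_uniq.
  - exact: enum_uniq.
  by move=> x; rewrite mem_filter !mem_enum /= negbK andbT.
by lia.
Qed.

Lemma extendT_cost i v : v \notin t i ->
  (extendT E t i v).2 <= 6 * h + 18 * hsize E + 18.
Proof.
move=> vt; rewrite /extendT bind_cost; set es := map _ _; set s := v :: _.
have es_uniq : all uniq es.
  by rewrite all_map; apply/allP => e _; apply: enum_uniq.
have s_uniq : uniq s by rewrite /= mem_enum vt enum_uniq.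
have sE : s =i v |: t i by move=> x; rewrite !inE mem_enum.
have s_small : size s <= h.+1 by rewrite /= -cardE ltnS.
have es_small : \sum_(e <- es) (10 * size e + 6) <= 16 * hsize E + 6.
  by rewrite big_map; apply: sum_edges_leq.
have : (closureT es s).2 <= 6 * h + 16 * hsize E + 16.
  apply: leq_trans (closureT_cost s es_uniq) _.
  have le_s := leq_add (leq_mul (leqnn 6) s_small) (leqnn 4).
  by apply: leq_trans (leq_add le_s es_small) _; lia.
have := closureTE E s_uniq sE; rewrite -/es.
case: (closureT es s) => r c /= -> le_c.
case: ifP => [_|/negbT /MH_leq_hsize]; first by rewrite /=; lia.
rewrite cardE bind_cost => le_f; have := lengthT_cost (enum (MH E (v |: t i))).
by case: (lengthT _) => n cn; rewrite /= addn0 addn1; lia.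
Qed.

Lemma chooseT_cost es : (forall i, perm_eq (es i) (enum E)) ->
  (chooseT t es).2 <= k * (6 * h + 6 * hsize E + 9) + 1.
Proof.
move=> esE; rewrite addn1.
have -> : k * (6 * h + 6 * hsize E + 9) =
    (6 * h + 6 * hsize E + 8).+1 * size (enum 'I_k).
  by rewrite size_enum_ord mulnC addnS.
apply: foldT_cost_const => r i; rewrite !bind_cost.
set A := (mark _ _).1; set m := (lengthT _).1.
set a := fun f : {set T} => _.
have : (findT a (es i)).2 <= 6 * hsize E + 4.
  have := sum_edges_leq 3 3 (esE i) => le_s.
  have := @findT_cost _ a (fun f => (3 * size (enum f)).+2) (es i).
  under eq_bigr do rewrite -addn3.
  move=> le_f; apply: leq_trans (le_f _) _; last by lia.
  by move=> f; apply: contains_cost.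
have := mark_cost (enum (t i)) set0; have := lengthT_cost (enum (t i)).
have := unmark_cost (enum (t i)) A; have := t_small i; rewrite -!cardE.
by case: (findT a (es i)) => -[f|] c /=; lia.
Qed.

End StepCosts.
End RoutineCosts.

Lemma neq_setT_notin (T : finType) (S : {set T}) :
  S != [set: T] -> exists x, x \notin S.
Proof. by rewrite -subTset => /subsetPn[x _ xS]; exists x. Qed.

(** * The closure operator M_H *)

Section Closure.
Variables (T : finType) (E : {set {set T}}).
Implicit Types e f S : {set T}.

Lemma sub_MH S : S \subset MH E S.
Proof. by apply/bigcapsP => e; rewrite inE => /andP[]. Qed.

Lemma MH_sub S e : e \in E -> S \subset e -> MH E S \subset e.
Proof. by move=> eE Se; apply: bigcap_inf; rewrite inE eE. Qed.

Lemma MHK S : MH E (MH E S) = MH E S.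
Proof.
apply/eqP; rewrite eqEsubset sub_MH andbT; apply/bigcapsP => e.
by rewrite inE => /andP[eE Se]; apply: MH_sub => //; apply: MH_sub.
Qed.

Lemma MH_set0 : reduced E -> MH E set0 = set0.
Proof.
move=> /eqP rE; apply/eqP; rewrite -subset0 -{2}rE.
by apply/bigcapsP => e eE; apply: MH_sub; rewrite ?sub0set.
Qed.

Lemma KH_neq0 S : MH E S != [set: T] -> KH E S != set0.
Proof. by apply: contraNneq => K0; rewrite /MH K0 big_set0. Qed.

(** A closed [e] is the intersection of the edges above it, so one of them must miss [v]; if there
    were none, [e] would be V. *)
Lemma MH_closed_notin e v : MH E e = e -> v \notin e ->
  exists f, [/\ f \in E, e \subset f & v \notin f].
Proof.
move=> eE ve; have /exists_inP[f] : [exists f in KH E e, v \notin f].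
  apply: contraR ve; rewrite negb_exists_in => /forall_inP no_f.
  by rewrite -eE; apply/bigcapP => f /no_f; rewrite negbK.
by rewrite inE => /andP[fE ef] vf; exists f.
Qed.

End Closure.

(** * Semi-ladders bound the number of updates of an entry *)

Section Ladders.
Variables (T : finType) (E : {set {set T}}).
Implicit Types (e S : {set T}) (s : seq (T * {set T})).

(* Semi-ladders are listed from the last pair to the first, so that a new     *)
(* pair is added at the head.                                                 *)
Definition ladder e s : bool :=
  [&& all (fun p : T * {set T} => (p.2 \in E) && (p.1 \notin p.2)) s,
      pairwise (fun p q : T * {set T} => q.1 \in p.2) s &
      all (fun p : T * {set T} => p.1 \in e) s].

Lemma flat_ladder d e s : flat E d -> ladder e s -> size s <= d.+1.
Proof.
move=> flatE /and3P[/allP sE s_ladder _]; rewrite leqNgt; apply/negP => s_long.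
have [p0 _] : {p0 | p0 \in s}.
  by case: (s) s_long => // p s' _; exists p; apply: mem_head.
(* The list runs from the last pair to the first, so indices are reversed; [d.+2] pairs form the
   forbidden [d.+1]-semi-ladder. *)
pose p (i : 'I_d.+2) := nth p0 s (d.+1 - i).
have lt_p i : d.+1 - i < size s by apply: leq_ltn_trans (leq_subr _ _) s_long.
have p_in i : p i \in s by rewrite mem_nth.
apply: (flatE (fun i => (p i).1) (fun i => (p i).2)); split=> [i|i|i j lt_ij].
- by case/andP: (sE _ (p_in i)).
- by case/andP: (sE _ (p_in i)).
apply: (pairwiseP p0 s_ladder); rewrite ?inE //.
by have := ltn_ord j; lia.
Qed.

(** An edge above [e] that misses [v] contains all earlier ladder vertices, since these lie in
    [e]. *)
Lemma ladder_extend e v s : MH E e = e -> v \notin e -> ladder e s ->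
  exists f, ladder (MH E (v |: e)) ((v, f) :: s).
Proof.
move=> eE ve /and3P[sE s_ladder s_in].
have [f [fE ef vf]] := MH_closed_notin eE ve; exists f.
have sub := subsetP (sub_MH E (v |: e)).
rewrite /ladder /= fE vf sE s_ladder sub ?setU11 //= andbT; apply/andP; split.
  by apply: sub_all s_in => p; apply: (subsetP ef).
by apply: sub_all s_in => p pe; apply: sub; rewrite inE pe orbT.
Qed.

(* The bound is [d] and not [d.+1] because any vertex outside the new closure *)
(* extends the ladder once more.                                              *)
Lemma ladder_extend_size d e v s : flat E d -> MH E e = e -> v \notin e ->
    MH E (v |: e) != [set: T] -> ladder e s ->
  exists2 f, ladder (MH E (v |: e)) ((v, f) :: s) & size s < d.
Proof.
move=> flatE eE ve MT /(ladder_extend eE ve)[f lf]; exists f => //.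
have [u uM] := neq_setT_notin MT.
by have [f' /(flat_ladder flatE)] := ladder_extend (MHK E _) uM lf.
Qed.

End Ladders.

Lemma first_mem (A : eqType) (a : pred A) (l : seq A) x :
  first a l = Some x -> (x \in l) && a x.
Proof.
rewrite /first => lx; have : x \in filter a l.
  by case: (filter a l) lx => //= y l' [->]; apply: mem_head.
by rewrite mem_filter andbC.
Qed.

Lemma first_exists (A : eqType) (a : pred A) (l : seq A) x :
  x \in l -> a x -> exists y, first a l = Some y.
Proof.
move=> xl ax; have : x \in filter a l by rewrite mem_filter ax.
by rewrite /first; case: (filter a l) => //= y l' _; exists y.
Qed.

(** * Correctness and cost of the search *)

Section Search.
Variables (T : finType) (E : {set {set T}}) (d k : nat).
Variables (vo : seq 'I_k -> seq T) (eo : seq 'I_k -> 'I_k -> seq {set T}).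
Hypotheses (k_gt0 : 0 < k) (flatE : flat E d) (noV : [set: T] \notin E).
Hypothesis voT : forall p, perm_eq (vo p) (enum T).
Hypothesis eoE : forall p i, perm_eq (eo p i) (enum E).
Implicit Types (p : seq 'I_k) (t : {ffun 'I_k -> {set T}}).
Implicit Types (s : 'I_k -> seq (T * {set T})) (r : option {set {set T}}).

(* The ladder [s i] has one pair for each update made to the i-th entry, and  *)
(* fewer than [m] updates remain possible.                                    *)
Definition search_inv t s m : Prop :=
  [/\ forall i, t i = set0 \/ exists2 e, e \in E & t i \subset e,
      forall i, MH E (t i) = t i,
      forall i, ladder E (t i) (s i),
      forall i, size (s i) <= d &
      d * k < m + \sum_i size (s i)].

(* [set0] is allowed as an entry in order to pad covers with fewer edges. *)
Definition coverable t : Prop :=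
  exists g : 'I_k -> {set T},
  [/\ forall i, g i = set0 \/ g i \in E, forall i, t i \subset g i &
      forall x, exists i, x \in g i].

Definition sound r : Prop :=
  forall F, r = Some F -> is_cover E F /\ #|F| <= k.

Lemma search_inv_upd t s m v i : search_inv t s m.+1 -> v \notin t i ->
    MH E (v |: t i) != [set: T] ->
  exists s', search_inv (upd t i (MH E (v |: t i))) s' m.
Proof.
case=> t_edge tE ts sd lt_m vt MT.
have [f lf lt_d] := ladder_extend_size flatE (tE i) vt MT (ts i).
exists (fun j => if j == i then (v, f) :: s i else s j); split.
- move=> j; rewrite ffunE; case: eqP => // _; right.
  have /set0Pn[e] := KH_neq0 MT.
  by rewrite inE => /andP[eE te]; exists e => //; apply: MH_sub.
- by move=> j; rewrite ffunE; case: eqP => // _; apply: MHK.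
- by move=> j; rewrite ffunE; case: eqP.
- by move=> j; case: eqP => // _; apply: lt_d.
move: lt_m; rewrite (bigD1 i) //= [X in _ -> _ < m + X](bigD1 i) //= eqxx.
rewrite [X in _ -> _ < _ + (_ + X)](eq_bigr (fun j => size (s j))).
  by rewrite addSnnS.
by move=> j /negPf ->.
Qed.

Lemma search_inv_leq t s m i : search_inv t s m -> #|t i| <= hsize E.
Proof.
case=> /(_ i) [->|[e eE te]] *; first by rewrite cards0.
by rewrite (leq_trans (subset_leq_card te)) // edge_leq_hsize.
Qed.

(** Containing [v], [g i] is an edge rather than padding, so the closure of [v |: t i] stays inside
    it; it is not V because V is not an edge. *)
Lemma coverable_upd t v (g : 'I_k -> {set T}) i :
    (forall i, g i = set0 \/ g i \in E) -> (forall i, t i \subset g i) ->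
    (forall x, exists i, x \in g i) -> v \in g i ->
  MH E (v |: t i) != [set: T] /\ coverable (upd t i (MH E (v |: t i))).
Proof.
move=> gE tg g_cover vg; have giE : g i \in E.
  by case: (gE i) => // gi0; rewrite gi0 inE in vg.
have Mg : MH E (v |: t i) \subset g i.
  by apply: MH_sub => //; rewrite subUset sub1set vg tg.
split.
  apply: contraNneq noV => MT; rewrite MT subTset in Mg.
  by rewrite -(eqP Mg).
by exists g; split=> // j; rewrite ffunE; case: eqP => [->|].
Qed.

Lemma chosen_edges_sound p t s m : search_inv t s m ->
  union_of t = [set: T] -> sound (Some (chosen_edges eo p t)).
Proof.
case=> t_edge _ _ _ _ tT F [<-]; split; first (apply/andP; split).
- apply/subsetP => f; rewrite inE => /existsP[i /eqP/first_mem/andP[+ _]].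
  by rewrite (perm_mem (eoE p i)) mem_enum.
- rewrite -subTset -tT; apply/bigcupsP => i _; apply/subsetP => x xt.
  have [ti0|[e eE te]] := t_edge i; first by rewrite ti0 inE in xt.
  have [|f fi] :=
    @first_exists _ (fun e : {set T} => t i \subset e) (eo p i) e _ te.
    by rewrite (perm_mem (eoE p i)) mem_enum.
  apply/bigcupP; exists f.
    by rewrite inE; apply/existsP; exists i; apply/eqP.
  by case/first_mem/andP: fi => _ /subsetP; apply.
(* The selected edges lie in the image of [h] on [k] indices; [set0] is only a default where nothing
   is selected. *)
pose h i := odflt set0 (first (fun e : {set T} => t i \subset e) (eo p i)).
rewrite -[k in _ <= k]card_ord (leq_trans _ (leq_imset_card h _)) //.
apply/subset_leq_card/subsetP => f; rewrite inE => /existsP[i /eqP fi].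
by apply/imsetP; exists i => //; rewrite /h fi.
Qed.

(** [K] bounds the cost of each recursive call, whose specification is assumed here so that the
    outer induction can supply it. Of the 22, 18 come from [extendT] and 4 from advancing,
    overwriting, testing and restoring. *)
Lemma solve_loop_spec p t v K s m :
    search_inv t s m -> v \notin union_of t ->
    (forall i : 'I_k, MH E (v |: t i) != [set: T] -> exists r c,
       [/\ solve_call E vo eo (rcons p i) (upd t i (MH E (v |: t i))) r c,
           c <= K, sound r &
           coverable (upd t i (MH E (v |: t i))) -> r <> None]) ->
  forall l : seq 'I_k, exists r c,
    [/\ solve_loop E vo eo p t v l r c,
        c <= size l * (24 * hsize E + 22 + K) + 1, sound r &
        (exists2 i, i \in l & MH E (v |: t i) != [set: T] /\
                               coverable (upd t i (MH E (v |: t i)))) ->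
        r <> None].
Proof.
move=> inv vt IH; elim=> [|i l [r [c [run le_c snd_r cmp_r]]]].
  by exists None, 1; split=> //; [apply: loop_end | case].
have ext : (extendT E t i v).2 <= 24 * hsize E + 18.
  have t_small i' := search_inv_leq i' inv.
  apply: leq_trans (extendT_cost E t_small _) _; last by lia.
  by apply: contra vt => vti; apply/bigcupP; exists i.
have [MT|MT] := eqVneq (MH E (v |: t i)) [set: T].
  exists r, (1 + (extendT E t i v).2 + c); split=> //.
  - exact: loop_skip.
  - by rewrite [size (_ :: _)]/= [_.+1 * (_ + _)]mulSn; lia.
  case=> j; rewrite inE => /orP[/eqP-> []|jl Hj]; first by rewrite MT eqxx.
  by apply: cmp_r; exists j.
have [[F|] [c' [run' le_c' snd_r' cmp_r']]] := IH i MT.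
  exists (Some F), (1 + (extendT E t i v).2 + 1 + c' + 1); split=> //.
  - exact: loop_success.
  - by rewrite [size (_ :: _)]/= [_.+1 * (_ + _)]mulSn; lia.
exists r, (1 + (extendT E t i v).2 + 1 + c' + 1 + 1 + c); split=> //.
- exact: loop_next.
- by rewrite [size (_ :: _)]/= [_.+1 * (_ + _)]mulSn; lia.
case=> j; rewrite inE => /orP[/eqP-> [_ /cmp_r']|jl Hj] //.
by apply: cmp_r; exists j.
Qed.

Lemma solve_call_spec m p t s : search_inv t s m -> exists r c,
  [/\ solve_call E vo eo p t r c,
      c <= 65 * (k * maxn 1 (hsize E)) * \sum_(j < m) k ^ j,
      sound r & coverable t -> r <> None].
Proof.
elim: m p t s => [|m IH] p t s inv.
  (* With budget 0 the ladders would have total length above [d * k], though each has length at most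
     [d]. *)
  case: inv => _ _ _ sd; rewrite add0n ltnNge => /negP[].
  have -> : d * k = \sum_(i < k) d by rewrite sum_nat_const card_ord mulnC.
  exact: leq_sum.
(* The sum splits as 1 for this call plus [k] times the sum for each of its subcalls. *)
rewrite big_ord_recl expn0.
under eq_bigr do rewrite expnS.
rewrite -big_distrr /=; set N := maxn 1 (hsize E); set K := \sum_(_ < m) _.
have t_small i := search_inv_leq i inv.
have le_unc := uncoveredT_cost t_small (voT p).
have N_gt0 : 0 < N by rewrite leq_max.
have leHN : hsize E <= N by rewrite leq_maxr.
have kN : k <= k * N by rewrite leq_pmulr.
have kH : k * hsize E <= k * N by rewrite leq_mul2l leHN orbT.
have [tT|tT] := eqVneq (union_of t) [set: T].
  eexists _, _; split; first exact: solve_covered.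
  - have le_ch := chooseT_cost t_small (eoE p).
    have : 1 + (uncoveredT t (vo p)).2 + (chooseT t (eo p)).2 <= 65 * (k * N).
      by move: le_ch; rewrite !mulnDr; lia.
    by move/leq_trans; apply; rewrite leq_pmulr ?addn_gt0.
  - exact: chosen_edges_sound inv tT.
  by [].
have [x xt] := neq_setT_notin tT.
have [|v fv] := @first_exists _ (fun x => x \notin union_of t) (vo p) x _ xt.
  by rewrite (perm_mem (voT p)) mem_enum.
have /andP[_ vt] := first_mem fv.
have [|r [c [run le_c snd_r cmp_r]]] :=
    @solve_loop_spec p t v (65 * (k * N) * K) s _ inv vt _ (enum 'I_k).
  move=> i MT; have [|s' inv'] := search_inv_upd (i := i) inv _ MT.
    by apply: contra vt => vti; apply/bigcupP; exists i.
  exact: IH inv'.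
exists r, (1 + (uncoveredT t (vo p)).2 + c); split=> //.
- exact: solve_branch fv run.
(* Apart from its subcalls, a branching call costs at most 32 k ||H|| + 26 k + 7, whence 65 = 32 +
   26 + 7. *)
- rewrite mulnDr muln1 (mulnCA _ k).
  by move: le_c; rewrite size_enum_ord !(mulnDr k); lia.
case=> g [gE tg g_cover]; apply: cmp_r; have [i vg] := g_cover v.
by exists i; [rewrite mem_enum | apply: coverable_upd vg].
Qed.

End Search.

(** * From the search invariant to the final bound *)

Lemma has_cover_coverable (T : finType) (E : {set {set T}}) k :
  has_cover E k -> coverable E [ffun _ : 'I_k => set0].
Proof.
move=> /existsP[F /andP[/andP[/subsetP FE /eqP FT] Fk]].
(* Indices beyond the size of [F] get the default [set0], which pads the cover to [k] sets. *)
exists (fun i => nth set0 (enum F) i); split=> [i|i|x].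
- have [lt_i|ge_i] := ltnP i (size (enum F)); last by left; rewrite nth_default.
  by right; apply: FE; rewrite -mem_enum mem_nth.
- by rewrite ffunE sub0set.
have : x \in cover F by rewrite FT inE.
case/bigcupP => e eF xe; have lt_e : index e (enum F) < k.
  by rewrite (leq_trans _ Fk) // cardE index_mem mem_enum.
by exists (Ordinal lt_e); rewrite nth_index // mem_enum.
Qed.

Lemma sum_powers_leq k n : 1 < k -> (\sum_(j < n.+1) k ^ j).+1 <= 2 * k ^ n.
Proof.
move=> k_gt1; elim: n => [|n IH]; first by rewrite big_ord1.
rewrite big_ord_recr expnS /=; move: IH; move: (\sum_(_ < _) _) (k ^ n).
by move=> a b; nia.
Qed.

Theorem theorem3 :
  exists C0 : nat, forall d : nat, 0 < d -> exists C1 : nat,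
  forall (k : nat) (T : finType) (E : {set {set T}})
         (vo : seq 'I_k -> seq T) (eo : seq 'I_k -> 'I_k -> seq {set T}),
    0 < k ->
    reduced E -> flat E d -> [set: T] \notin E ->
    (forall p, perm_eq (vo p) (enum T)) ->
    (forall p i, perm_eq (eo p i) (enum E)) ->
    exists (r : option {set {set T}}) (c : nat),
      [/\ solve_call E vo eo [::] [ffun=> set0] r c,
          c <= (if 1 < k then C0 else C1) * (k ^ (d * k) * k * maxn 1 (hsize E)),
          has_cover E k ->
            exists F : {set {set T}}, [/\ r = Some F, #|F| <= k & is_cover E F] &
          ~~ has_cover E k -> r = None].
Proof.
(* For k > 1 the powers sum to at most 2 k^(dk), giving 2 * 65; for k = 1 they are [d.+1] ones. *)
exists 130 => d d_gt0; exists (65 * d.+1).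
move=> k T E vo eo k_gt0 rE flatE noV voT eoE.
(* Reducedness makes [set0] closed, so the search starts with empty ladders and the full budget. *)
have inv : search_inv E d [ffun _ : 'I_k => set0] (fun=> [::]) (d * k).+1.
  split=> // [i|i|]; rewrite ?ffunE; [by left | exact: MH_set0 | lia].
have [r [c [run le_c snd_r cmp_r]]] :=
  solve_call_spec k_gt0 flatE noV voT eoE [::] inv.
exists r, c; split=> // [|cov|no_cov].
- apply: leq_trans le_c _; set N := maxn _ _.
  case: ltnP => [k_gt1|k_le1].
    have := sum_powers_leq (d * k) k_gt1.
    by move: (\sum_(_ < _) _) (k ^ _) => a b; nia.
  have -> : k = 1 by lia.
  rewrite muln1 exp1n; under eq_bigr do rewrite exp1n.
  by rewrite sum_nat_const card_ord; lia.
- have := cmp_r (has_cover_coverable cov).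
  case: r run snd_r cmp_r => // F _ snd_F _ _.
  by exists F; have [] := snd_F F erefl.
case: r run snd_r cmp_r => // F _ /(_ F erefl)[FE Fk] _.
by case/existsP: no_cov; exists F; rewrite FE.
Qed.
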